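(* Let $I=[0,1]$, let $f:I\to\mathbb{R}$ be continuous, and let $\beta\in(1,2)$. Then there exists a sequence $(f_n)$ of fractal functions $f_n: I\to\mathbb{R}$ converging uniformly to $f$ on $I$ and such that $\dim_B G_{f_n}=\beta$ for every $n$.
   Context: Fractal (interpolation) function: let $0=x_0<x_1<\dots<x_N=1$ with $N\ge 2$, and let $y_0,\dots,y_N\in\mathbb{R}$. Put $I=[0,1]$ and $I_i=[x_{i-1},x_i]$ for $i\in J=\{1,\dots,N\}$. Let $L_i:I\to I_i$ be the affine maps with $L_i(x_0)=x_{i-1}$ and $L_i(x_N)=x_i$, and let $F_i:I\times\mathbb{R}\to\mathbb{R}$ be functions that are continuous in the first variable and contractive in the second variable (Lipschitz constant $<1$), with $F_i(x_0,y_0)=y_{i-1}$ and $F_i(x_N,y_N)=y_i$. Set $w_i(x,y)=(L_i(x),F_i(x,y))$. The iterated function system $(I\times\mathbb{R},\{w_i\}_{i\in J})$ has a unique attractor, i.e. a unique nonempty compact set $G$ with $G=\bigcup_{i\in J}w_i(G)$, and $G$ is the graph of a continuous function $I\to\mathbb{R}$ taking the value $y_i$ at $x_i$ for $i=0,\dots,N$. A function arising in this way is called a fractal interpolation function, or fractal function. $G_g=\{(x,g(x)):x\in I\}\subset\mathbb{R}^2$ denotes the graph of $g$. For a bounded nonempty set $F$, with $N_\delta(F)$ the smallest number of sets of diameter at most $\delta$ covering $F$, the box dimension is $\dim_B F=\lim_{\delta\to0^+}\frac{\log N_\delta(F)}{-\log\delta}$; $\dim_B F=\beta$ means that the limit exists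 and equals $\beta$. *)

(* Defs.v *)
From HB Require Import structures.
From mathcomp Require Import all_boot all_order all_algebra.
From mathcomp Require Import all_classical all_reals all_analysis.
Set Implicit Arguments.
Unset Strict Implicit.
Unset Printing Implicit Defensive.
Import Order.TTheory GRing.Theory Num.Theory.
Import numFieldNormedType.Exports.
Local Open Scope classical_set_scope.
Local Open Scope ring_scope.

(* The product topology on R * R is the usual one, but its library norm is the
   sup norm; the Euclidean distance is therefore written out. *)
Definition edist (R : realType) (p q : R * R) : R :=
  Num.sqrt ((p.1 - q.1) ^+ 2 + (p.2 - q.2) ^+ 2).

Definition diam_le (R : realType) (delta : R) (A : set (R * R)) : Prop :=
  forall p q, A p -> A q -> edist p q <= delta.

Definition covered_by (R : realType) (delta : R) (E : set (R * R)) (n : nat)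
    : Prop :=
  exists A : 'I_n -> set (R * R),
    (forall i, diam_le delta (A i)) /\ E `<=` \bigcup_i A i.

(* The default value 0 is only used when E has no finite cover, which does not
   occur for bounded E and delta > 0. *)
Definition covering_number (R : realType) (delta : R) (E : set (R * R)) : nat :=
  xget 0%N [set n | covered_by delta E n /\
                    forall m, covered_by delta E m -> (n <= m)%N].

Definition box_dim_eq (R : realType) (E : set (R * R)) (beta : R) : Prop :=
  [/\ E !=set0, bounded_set E &
      ln ((covering_number delta E)%:R : R) / - ln delta
        @[delta --> 0^'+] --> beta].

Definition unit_interval (R : realType) : set R := `[0, 1].

Definition graph_on_I (R : realType) (g : R -> R) : set (R * R) :=
  [set (x, g x) | x in @unit_interval R].

Definition affine_map (R : realType) (h : R -> R) : Prop :=
  exists a b : R, forall t, h t = a * t + b.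

(* The maps are indexed from 0: the index i : 'I_N stands for i + 1 in J.
   Only the values of the nodes and ordinates at 0, ..., N, and those of the
   maps at first arguments in [0, 1], are constrained and used. *)
Record fractal_ifs (R : realType) := FractalIFS {
  ifs_N : nat;
  ifs_x : nat -> R;
  ifs_y : nat -> R;
  ifs_L : 'I_ifs_N -> R -> R;
  ifs_F : 'I_ifs_N -> R -> R -> R;
  ifs_N_ge2 : (2 <= ifs_N)%N;
  ifs_x_first : ifs_x 0 = 0;
  ifs_x_last : ifs_x ifs_N = 1;
  ifs_x_incr : forall i : 'I_ifs_N, ifs_x i < ifs_x i.+1;
  ifs_L_affine : forall i, affine_map (ifs_L i);
  ifs_L_first : forall i : 'I_ifs_N, ifs_L i (ifs_x 0) = ifs_x i;
  ifs_L_last : forall i : 'I_ifs_N, ifs_L i (ifs_x ifs_N) = ifs_x i.+1;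
  ifs_F_continuous : forall i y,
    {within @unit_interval R, continuous (fun x => ifs_F i x y)};
  ifs_F_contractive : forall i, exists c : R,
    [/\ 0 <= c, c < 1 & forall x y y', @unit_interval R x ->
        `|ifs_F i x y - ifs_F i x y'| <= c * `|y - y'|];
  ifs_F_first : forall i : 'I_ifs_N, ifs_F i (ifs_x 0) (ifs_y 0) = ifs_y i;
  ifs_F_last : forall i : 'I_ifs_N,
    ifs_F i (ifs_x ifs_N) (ifs_y ifs_N) = ifs_y i.+1
}.

Definition ifs_w (R : realType) (S : fractal_ifs R) (i : 'I_(ifs_N S))
    (p : R * R) : R * R :=
  (ifs_L i p.1, ifs_F i p.1 p.2).

Definition is_attractor (R : realType) (S : fractal_ifs R) (G : set (R * R))
    : Prop :=
  [/\ G `<=` @unit_interval R `*` setT, G !=set0, compact G &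
      G = \bigcup_i (@ifs_w R S i @` G)].

Definition fractal_function (R : realType) (g : R -> R) : Prop :=
  exists S : fractal_ifs R,
    [/\ {within @unit_interval R, continuous g},
        forall i, (i <= ifs_N S)%N -> g (ifs_x S i) = ifs_y S i &
        is_attractor S (graph_on_I g)].

(* Main.v *)
Require Import Defs.
From HB Require Import structures.
From mathcomp Require Import all_boot all_order all_algebra.
From mathcomp Require Import all_classical all_reals all_analysis.
From mathcomp Require Import ring lra.
Import Order.TTheory GRing.Theory Num.Theory.
Import numFieldNormedType.Exports.
Local Open Scope classical_set_scope.
Local Open Scope ring_scope.
Set Implicit Arguments.
Unset Strict Implicit.
Unset Printing Implicit Defensive.

(** Every continuous function g on [0, 1] is a fractal function: the maps
    (x, y) |-> (L_i x, g (L_i x) + (y - g x) / 2) contract vertically by 1/2 and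
    send the graph of g onto its own halves.  It is therefore enough to
    approximate f uniformly by continuous functions whose graphs have dimension
    beta.

    Put a = 2 ^ (beta - 2), so that 1/2 < a < 1.  The approximants are
    p + eps * T, where p is a Lipschitz function close to f (an interpolation of
    f by hat functions) and T x = \sum_i a ^ i * tent (2 ^ i * x) is a Takagi
    function, tent being the distance to the nearest integer.

    On a dyadic interval of length 2 ^ (-k) the terms of T of index i < k are
    affine, those of index i > k vanish at both ends and at the midpoint, and
    the term of index k is a single tooth.  Hence the second difference of T on
    that interval is exactly - a ^ k (lemma takagi_second_difference).  A
    Lipschitz summand changes it by O(2 ^ (-k)), which is negligible as
    a > 1/2, so p + eps * T oscillates by at least a multiple of a ^ k on every
    short dyadic interval.  Summing two geometric series shows that it varies by
    at most a multiple of a ^ k between points at distance 2 ^ (-k) (lemma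
    takagi_dyadic_holder).

    These two facts give the dimension.  If delta is comparable to 2 ^ (-k),
    there are about 2 ^ k columns of width delta, and the graph meets about
    a ^ k / delta boxes of side delta in each: the covering number is comparable
    to (4 a) ^ k = 2 ^ (k beta).  The upper bound is a count of boxes (lemma
    graph_cover); the lower bound exhibits, by the intermediate value theorem,
    as many points of the graph that are pairwise more than delta apart (lemma
    covering_lower_bound). *)

(** * Coverings and packings of graphs *)

Lemma covered_by_finType (R : realType) (T : finType) (delta : R)
    (E : set (R * R)) (A : T -> set (R * R)) :
  (forall t, diam_le delta (A t)) -> E `<=` \bigcup_t A t ->
  Defs.covered_by delta E #|T|.
Proof.
move=> dA EA; exists (fun i => A (enum_val i)); split=> // p /EA[t _ At].
by exists (enum_rank t); rewrite // enum_rankK.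
Qed.

(** A set of diameter at most delta contains at most one of the points p t. *)
Lemma packing_le_covering (R : realType) (T : finType) (delta : R)
    (E : set (R * R)) (p : T -> R * R) (n : nat) :
  (forall t, E (p t)) ->
  (forall t u, t != u -> delta < Defs.edist (p t) (p u)) ->
  Defs.covered_by delta E n -> (#|T| <= n)%N.
Proof.
move=> Ep sep [A [dA EA]].
have cellP t : exists i, A i (p t) by have [i _ Ai] := EA _ (Ep t); exists i.
have [cell cellA] := choice cellP.
rewrite -[n]card_ord; apply: (@leq_card _ _ cell) => t u cell_tu.
apply: contraPeq (lexx delta) => /sep.
by rewrite ltNge (dA (cell u)) // -cell_tu.
Qed.

Lemma covering_number_spec (R : realType) (delta : R) (E : set (R * R))
    (n : nat) : Defs.covered_by delta E n ->
  Defs.covered_by delta E (covering_number delta E) /\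
  (covering_number delta E <= n)%N.
Proof.
move=> En; have exP : exists m, `[< Defs.covered_by delta E m >].
  by exists n; apply/asboolP.
have [cov min] : [set m | Defs.covered_by delta E m /\
    forall k, Defs.covered_by delta E k -> (m <= k)%N]
    (covering_number delta E).
  rewrite /covering_number; case: xgetP => [m -> //|] /(_ (ex_minn exP)) [].
  by case: ex_minnP => m /asboolP ? min; split=> // k /asboolP /min.
by split=> //; apply: min.
Qed.

Lemma edist_sym (R : realType) (p q : R * R) : Defs.edist p q = Defs.edist q p.
Proof. by rewrite /Defs.edist -sqrrN opprB -[X in _ + X]sqrrN opprB. Qed.

Lemma edist_ge1 (R : realType) (p q : R * R) : `|p.1 - q.1| <= Defs.edist p q.
Proof. by rewrite -sqrtr_sqr ler_wsqrtr// lerDl sqr_ge0. Qed.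

Lemma edist_ge2 (R : realType) (p q : R * R) : `|p.2 - q.2| <= Defs.edist p q.
Proof. by rewrite -sqrtr_sqr ler_wsqrtr// lerDr sqr_ge0. Qed.

Lemma edist_le (R : realType) (p q : R * R) :
  Defs.edist p q <= `|p.1 - q.1| + `|p.2 - q.2|.
Proof.
rewrite -[leRHS]ger0_norm ?addr_ge0// -[leRHS]sqrtr_sqr ler_wsqrtr//.
rewrite -[in leLHS](real_normK (num_real (p.1 - q.1))).
rewrite -[in leLHS](real_normK (num_real (p.2 - q.2))).
have := normr_ge0 (p.1 - q.1); have := normr_ge0 (p.2 - q.2); nra.
Qed.

(** Each of the n + 1 columns [j / n, (j + 1) / n] is paved by squares of side
    1 / n stacked around the value of g at its left end; 2 M + 1 of them suffice
    since g stays within M / n of that value. *)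
Lemma graph_cover (R : realType) (g : R -> R) (n M : nat) (delta : R) :
  (0 < n)%N -> 2 / n%:R <= delta ->
  (forall x y, `|x - y| <= n%:R^-1 -> `|g x - g y| <= M%:R / n%:R) ->
  Defs.covered_by delta (graph_on_I g) (n.+1 * (M.*2.+1)).
Proof.
move=> n0 nd gM; have n0' : 0 < n%:R :> R by rewrite ltr0n.
pose A (t : 'I_n.+1 * 'I_(M.*2.+1)) : set (R * R) := [set p |
  t.1%:R <= n%:R * p.1 <= t.1%:R + 1 /\
  t.2%:R <= n%:R * (p.2 - g (t.1%:R / n%:R)) + M%:R <= t.2%:R + 1].
have -> : (n.+1 * (M.*2.+1) = #|{: 'I_n.+1 * 'I_(M.*2.+1)}|)%N.
  by rewrite card_prod !card_ord.
apply: (@covered_by_finType _ _ _ _ A) => [t p q [p1 p2] [q1 q2]|].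
  apply: le_trans nd; apply: (le_trans (edist_le _ _)).
  have -> : 2 / n%:R = n%:R^-1 + n%:R^-1 :> R by rewrite mulrDl mul1r.
  by apply: lerD; rewrite -(ler_pM2l n0') -{1}(ger0_norm (ltW n0')) -normrM
    divff ?gt_eqF// ler_norml; lra.
move=> p [x]; rewrite /unit_interval/= in_itv/= => /andP[x0 x1] <-.
have nx0 : 0 <= n%:R * x by rewrite mulr_ge0// ltW.
have /andP[j0 j1] := truncn_itv nx0; move: j0 j1.
set j := Num.truncn _ => j0 j1.
(* The point x = 1 falls in the extra column j = n. *)
have jn : (j < n.+1)%N.
  by rewrite ltnS -(ler_nat R) (le_trans j0)// ler_piMr// ltW.
have gj : `|n%:R * (g x - g (j%:R / n%:R))| <= M%:R.
  rewrite normrM (ger0_norm (ltW n0')) mulrC -ler_pdivlMr//; apply: gM.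
  rewrite -(ler_pM2l n0') -{1}(ger0_norm (ltW n0')) -normrM mulrBr mulrCA.
  rewrite divff ?gt_eqF// mulr1 ger0_norm ?subr_ge0// lerBlDl.
  by rewrite -natr1 in j1; lra.
move: gj; rewrite ler_norml => /andP[gj0 gj1].
have h0 : 0 <= n%:R * (g x - g (j%:R / n%:R)) + M%:R by lra.
have /andP[l0 l1] := truncn_itv h0; move: l0 l1.
set l := Num.truncn _ => l0 l1.
have lM : (l < M.*2.+1)%N.
  by rewrite ltnS -(ler_nat R) (le_trans l0)// -addnn natrD; lra.
exists (Ordinal jn, Ordinal lM) => //; rewrite /A/=.
by move: j1 l1; rewrite -!natr1 => j1 l1; split; lra.
Qed.

(** Only the m columns of even index among 2 m are used: distinct ones are then
    more than delta apart.  In each of them g takes, by the intermediate value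
    theorem, the M + 1 values g u + 2 delta l with l <= M, and the points of the
    graph at these heights are more than delta apart as well. *)
Lemma covering_lower_bound (R : realType) (g : R -> R) (m M n : nat)
    (delta : R) :
  continuous g -> 0 < delta -> delta < (m.*2)%:R^-1 ->
  (forall j, (j < m)%N -> exists u v,
    [/\ j.*2%:R <= (m.*2)%:R * u <= j.*2%:R + 1,
        j.*2%:R <= (m.*2)%:R * v <= j.*2%:R + 1 &
        g u + 2 * delta * M%:R <= g v]) ->
  Defs.covered_by delta (graph_on_I g) n -> (m * M.+1 <= n)%N.
Proof.
move=> cg d0 dm osc.
have [->//|m_gt0] := posnP m.
have m0 : 0 < (m.*2)%:R :> R by rewrite ltr0n double_gt0.
have m1 : m.*2%:R != 0 :> R by rewrite gt_eqF.
have base (j : 'I_m) : exists u, exists v,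
    [/\ j.*2%:R <= (m.*2)%:R * u <= j.*2%:R + 1,
        j.*2%:R <= (m.*2)%:R * v <= j.*2%:R + 1 &
        g u + 2 * delta * M%:R <= g v] by exact: osc.
have [u uP] := choice base.
have pt (t : 'I_m * 'I_M.+1) : exists x,
    t.1.*2%:R <= (m.*2)%:R * x <= t.1.*2%:R + 1 /\
    g x = g (u t.1) + 2 * delta * t.2%:R.
  have [v [uj vj guv]] := uP t.1.
  have tM : 2 * delta * t.2%:R <= 2 * delta * M%:R.
    by apply: ler_wpM2l; [lra | rewrite ler_nat -ltnS].
  have t0 : 0 <= 2 * delta * t.2%:R by apply: mulr_ge0; [lra | exact: ler0n].
  have between a b : a <= b -> t.1.*2%:R <= (m.*2)%:R * a ->
      (m.*2)%:R * b <= t.1.*2%:R + 1 ->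
      Num.min (g a) (g b) <= g (u t.1) + 2 * delta * t.2%:R
        <= Num.max (g a) (g b) ->
      exists x, t.1.*2%:R <= (m.*2)%:R * x <= t.1.*2%:R + 1 /\
        g x = g (u t.1) + 2 * delta * t.2%:R.
    move=> ab ta tb /(IVT ab (continuous_subspaceT cg)) [x].
    rewrite in_itv/= => /andP[ax xb] gx; exists x; split=> //.
    by rewrite (le_trans ta) ?ler_pM2l//= (le_trans _ tb) ?ler_pM2l.
  move/andP: uj => [u0 u1]; move/andP: vj => [v0 v1].
  have [uv|vu] := leP (u t.1) v.
  - by apply: (between _ _ uv) => //; rewrite ge_min le_max; lra.
  - by apply: (between _ _ (ltW vu)) => //; rewrite ge_min le_max; lra.
have [x xP] := choice pt.
have -> : (m * M.+1 = #|{: 'I_m * 'I_M.+1}|)%N by rewrite card_prod !card_ord.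
apply: (@packing_le_covering _ _ _ _ (fun t => (x t, g (x t)))) => [t|t s ts].
  exists (x t) => //; have [/andP[x0 x1] _] := xP t.
  rewrite /unit_interval/= in_itv/= -(pmulr_rge0 _ m0) (le_trans _ x0)//=.
  rewrite -(ler_pM2l m0) mulr1 (le_trans x1)// natr1 ler_nat.
  by rewrite ltn_double.
wlog lts : t s ts / (t.1 < s.1)%N || (t.1 == s.1) && (t.2 < s.2)%N.
  move=> wl; have [tslt|] := boolP ((t.1 < s.1)%N ||
    (t.1 == s.1) && (t.2 < s.2)%N); first exact: wl.
  rewrite negb_or -leqNgt => /andP[s1 s2].
  rewrite edist_sym.
  apply: wl; first by rewrite eq_sym.
  move: s1; rewrite leq_eqVlt => /orP[/eqP/val_inj s1|->//].
  move: s2 ts; rewrite s1 eqxx ltnn/= -leqNgt leq_eqVlt.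
  move=> /orP[/eqP/val_inj|->//].
  by case: t s s1 => [? ?] [? ?] /= -> ->; rewrite eqxx.
have [xt gt] := xP t; have [xs gs] := xP s.
case/orP: lts => [t1s1|/andP[/eqP t1s1 t2s2]].
- apply: lt_le_trans (edist_ge1 _ _) => /=; rewrite distrC.
  rewrite (lt_le_trans dm)// -(ler_pM2l m0) divff//.
  rewrite -{1}(ger0_norm (ltW m0)) -normrM ler_normr; apply/orP; left.
  have : t.1.*2%:R + 2 <= s.1.*2%:R :> R.
    by rewrite -natrD ler_nat addn2 -doubleS leq_double.
  lra.
- apply: lt_le_trans (edist_ge2 _ _) => /=.
  rewrite distrC gs gt t1s1 opprD addrACA subrr add0r -mulrBr.
  rewrite ger0_norm; last first.
    by apply: mulr_ge0; [lra | rewrite subr_ge0 ler_nat ltnW].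
  have : t.2%:R + 1 <= s.2%:R :> R by rewrite natr1 ler_nat.
  nra.
Qed.

(** * Box dimension from dyadic bounds *)

Lemma dyadic_bracket (R : realType) (k0 : nat) (delta : R) :
  0 < delta -> delta < 2^-1 ^+ k0.+1 ->
  exists2 k, (k0 <= k)%N & 2^-1 ^+ k.+2 <= delta < 2^-1 ^+ k.+1.
Proof.
move=> d0 dk0.
have half_lt1 : `|2^-1 : R| < 1 by rewrite ger0_norm; lra.
have exP : exists k, (2^-1 : R) ^+ k <= delta.
  have [k _ /(_ k (leqnn k))/= kd] := cvgr0_norm_le _ (cvg_expr half_lt1) _ d0.
  by exists k; rewrite (le_trans (ler_norm _)).
case: (ex_minnP exP) => m md min_m.
have k0m : (k0.+1 < m)%N.
  rewrite ltnNge; apply/negP => mk0.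
  have : (2^-1 : R) ^+ k0.+1 <= 2^-1 ^+ m by apply: ler_wiXn2l => //; lra.
  by move=> /(lt_le_trans dk0); rewrite ltNge md.
case: m k0m md min_m => [//|[//|k]] k0k md min_m.
exists k => //; rewrite md ltNge /=; apply/negP => /min_m.
by rewrite ltnn.
Qed.

(** When - ln delta is k * ln 2 up to a bounded error, a covering number between
    two multiples of 2 ^ (k beta) has logarithm beta * (- ln delta) up to a
    bounded error D, and D / (- ln delta) tends to 0. *)
Lemma box_dim_of_dyadic_bounds (R : realType) (E : set (R * R)) (beta c C : R)
    (k0 : nat) :
  E !=set0 -> bounded_set E -> 0 <= beta -> 0 < c ->
  (forall k delta, (k0 <= k)%N -> 2^-1 ^+ k.+2 <= delta < 2^-1 ^+ k.+1 ->
    (forall n, Defs.covered_by delta E n -> c * (2 `^ beta) ^+ k <= n%:R) /\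
    exists2 n, Defs.covered_by delta E n & n%:R <= C * (2 `^ beta) ^+ k) ->
  box_dim_eq E beta.
Proof.
move=> E0 bE beta0 c0 scales; split=> //.
have ln2 : 0 < ln (2 : R) by rewrite ln_gt0; lra.
pose D : R := `|ln c| + `|ln C| + 2 * beta * ln 2.
apply/cvgrPdist_le => e e0.
near=> delta.
have d0 : 0 < delta by near: delta; exact: nbhs_right_gt.
have dk0 : delta < 2^-1 ^+ k0.+1.
  by near: delta; apply: nbhs_right_lt; rewrite exprn_gt0.
have lnd : ln delta <= - ((D + 1) / e).
  by near: delta; exact: (cvgrNy_le (@lnNy R)).
have [k k0k dk] := @dyadic_bracket R k0 delta d0 dk0.
have [low [n nE nC]] := scales k delta k0k dk.
have [NE Nn] := covering_number_spec nE.
move/low : NE; set N := covering_number delta E => cN.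
have B0 : 0 < (2 `^ beta) ^+ k :> R by rewrite exprn_gt0// powR_gt0.
have N0 : 0 < N%:R :> R by rewrite (lt_le_trans _ cN)// mulr_gt0.
have NC : N%:R <= C * (2 `^ beta) ^+ k by rewrite (le_trans _ nC)// ler_nat.
have C0 : 0 < C by rewrite -(pmulr_lgt0 _ B0) (lt_le_trans N0).
have lnB : ln ((2 `^ beta) ^+ k) = k%:R * (beta * ln 2) :> R.
  by rewrite lnXn ?powR_gt0// ln_powR mulr_natl.
have Nlow : ln c + k%:R * (beta * ln 2) <= ln N%:R.
  by rewrite -lnB -lnM ?posrE// ler_ln ?posrE// mulr_gt0.
have Nup : ln N%:R <= ln C + k%:R * (beta * ln 2).
  by rewrite -lnB -lnM ?posrE// ler_ln ?posrE// mulr_gt0.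
have ln_half j : ln ((2^-1 : R) ^+ j) = - (j%:R * ln 2).
  by rewrite lnXn// lnV ?posrE// mulNrn mulr_natl.
move/andP: dk => [dlow /ltW dup].
have dlow' : - ((k%:R + 2) * ln 2) <= ln delta.
  by rewrite -natrD addn2 -ln_half ler_ln ?posrE// exprn_gt0.
have dup' : ln delta <= - ((k%:R + 1) * ln 2).
  by rewrite natr1 -ln_half ler_ln ?posrE// exprn_gt0.
have numer : `|ln N%:R + beta * ln delta| <= D.
  have := ler_norm (ln C); have := ler_norm (- ln c); rewrite normrN.
  have := normr_ge0 (ln C); have := normr_ge0 (ln c).
  have bl : 0 <= beta * ln 2 by rewrite mulr_ge0// ltW.
  have := ler_wpM2l beta0 dlow'; have := ler_wpM2l beta0 dup'.
  rewrite /D ler_norml => *; apply/andP; split; lra.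
have D0 : 0 <= D by rewrite (le_trans _ numer).
have lnd0 : 0 < - ln delta.
  by rewrite ltrNr oppr0 (le_lt_trans lnd)// oppr_lt0 divr_gt0// ltr_wpDl.
have -> : beta - ln N%:R / - ln delta =
    - ((ln N%:R + beta * ln delta) / - ln delta).
  by field; rewrite -oppr_eq0 gt_eqF.
rewrite normrN normrM normfV (gtr0_norm lnd0) ler_pdivrMr// (le_trans numer)//.
have : (D + 1) / e <= - ln delta by lra.
by rewrite ler_pdivrMr// mulrC; lra.
Unshelve. all: by end_near.
Qed.

(** * Graphs of functions with matching Hoelder and oscillation bounds *)

(** Hoelder continuity of exponent s, in which 2 ^ (- s) = a, tested at dyadic
    scales. *)
Definition dyadic_holder (R : realType) (a C : R) (g : R -> R) : Prop :=
  forall k x y, `|x - y| <= 2^-1 ^+ k -> `|g x - g y| <= C * a ^+ k.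

(** The matching lower bound, on the oscillation of g over each dyadic interval
    of length 2 ^ (-k). *)
Definition dyadic_oscillation (R : realType) (a c : R) (k0 : nat) (g : R -> R)
    : Prop :=
  forall k j, (k0 <= k)%N -> exists u v,
    [/\ j%:R <= 2 ^+ k * u <= j%:R + 1, j%:R <= 2 ^+ k * v <= j%:R + 1 &
        g u + c * a ^+ k <= g v].

Lemma dyadic_holder_continuous (R : realType) (a C : R) (g : R -> R) :
  0 < a -> a < 1 -> 0 <= C -> dyadic_holder a C g -> continuous g.
Proof.
move=> a0 a1 C0 hg x; apply/cvgrPdist_le => e e0.
have a_lt1 : `|a| < 1 by rewrite gtr0_norm.
have e' : 0 < e / (C + 1) by rewrite divr_gt0// ltr_wpDl.
have [k _ /(_ k (leqnn k))/=] := cvgr0_norm_le _ (cvg_expr a_lt1) _ e'.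
rewrite ger0_norm ?exprn_ge0 ?(ltW a0)// => ak.
near=> y; apply: (@le_trans _ _ (C * a ^+ k)).
  apply: hg; near: y; exists (2^-1 ^+ k) => [|y]; last exact: ltW.
  exact: exprn_gt0.
rewrite ler_pdivlMr ?ltr_wpDl// in ak.
by apply: le_trans ak; rewrite mulrC ler_wpM2l ?exprn_ge0 ?(ltW a0)// lerDl.
Unshelve. all: by end_near.
Qed.

Lemma graph_compact (R : realType) (g : R -> R) :
  continuous g -> compact (graph_on_I g).
Proof.
move=> cg; apply: continuous_compact; last exact: segment_compact.
apply: continuous_subspaceT => x.
exact: (cvg_pair (f := id) (G := nbhs x) (H := nbhs (g x)) cvg_id (cg x)).
Qed.

Lemma graph_nonempty (R : realType) (g : R -> R) : graph_on_I g !=set0.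
Proof.
by exists (0, g 0), 0; rewrite // /unit_interval/= in_itv/= lexx ler01.
Qed.

Lemma powR2_subr2_bounds (R : realType) (beta : R) : 1 < beta -> beta < 2 ->
  1 < 2 * 2 `^ (beta - 2) /\ 2 `^ (beta - 2) < 1 :> R.
Proof.
move=> b1 b2; have ln2 : 0 < ln (2 : R) by rewrite ln_gt0// ltr1n.
have a0 : 0 < 2 `^ (beta - 2) :> R by rewrite powR_gt0.
split.
  rewrite -ltr_ln ?posrE ?mulr_gt0// ln1 lnM ?posrE// ln_powR.
  by rewrite -[X in X + _]mul1r -mulrDl pmulr_lgt0//; lra.
by rewrite -ltr_ln ?posrE// ln1 ln_powR pmulr_llt0 ?subr_lt0.
Qed.

(** With delta between 2 ^ (- k - 2) and 2 ^ (- k - 1), the covering number is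
    at most that of a paving at scale 2 ^ (- k - 3), and at least the size of a
    packing built on the dyadic intervals of length 2 ^ (- k - 1).  Both are
    comparable to (4 a) ^ k, and 4 a = 2 ^ beta. *)
Lemma box_dim_graph (R : realType) (beta c C : R) (k0 : nat) (g : R -> R) :
  1 < beta -> beta < 2 -> 0 < c -> 0 <= C ->
  dyadic_holder (2 `^ (beta - 2)) C g ->
  dyadic_oscillation (2 `^ (beta - 2)) c k0 g ->
  box_dim_eq (graph_on_I g) beta.
Proof.
move=> b1 b2 c0 C0; set a := 2 `^ _ => hg og.
have a0 : 0 < a by rewrite powR_gt0.
have a4 : 2 `^ beta = 2 * 2 * a.
  rewrite -[beta in LHS](subrK 2) powRD; last by rewrite pnatr_eq0 implybT.
  by rewrite powR_mulrn// mulrC expr2.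
have [/ltW a2 a1] : 1 < 2 * a /\ a < 1 by exact: powR2_subr2_bounds.
have cg := dyadic_holder_continuous a0 a1 C0 hg.
have gn : graph_on_I g !=set0 := graph_nonempty g.
apply: (@box_dim_of_dyadic_bounds _ _ _ (c * a)
  (2 * (2 * C + 3) * (2 * 2 * a) ^+ 3) k0) => //.
- exact/compact_bounded/graph_compact.
- lra.
- exact: mulr_gt0.
move=> k delta k0k /andP[dlow dup].
have d0 : 0 < delta by rewrite (lt_le_trans _ dlow)// exprn_gt0.
have pow2 j : 0 < (2 : R) ^+ j by rewrite exprn_gt0.
rewrite a4; split.
- move=> n; set M := Num.truncn (c * a ^+ k.+1 / (2 * delta)).
  have h0 : 0 <= c * a ^+ k.+1 / (2 * delta).
    by rewrite divr_ge0 ?mulr_ge0 ?exprn_ge0 ?ltW// mulr_gt0.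
  have /andP[] := truncn_itv h0; rewrite -/M => M0 M1.
  have pow2E : (2 ^ k).*2%:R = (2 : R) ^+ k.+1.
    by rewrite -mul2n -expnS natrX.
  move=> /(@covering_lower_bound _ _ (2 ^ k) M _ _ cg d0); rewrite pow2E.
  rewrite -exprVn => /(_ dup) bound.
  have {bound} : (2 ^ k * M.+1 <= n)%N.
    apply: bound => j _; have [u [v [uj vj guv]]] := og k.+1 j.*2 (leqW k0k).
    exists u, v; split=> //; apply: le_trans guv; rewrite lerD2l.
    by rewrite mulrC -ler_pdivlMr// mulr_gt0.
  rewrite -(ler_nat R) natrM natrX; apply: le_trans.
  have -> : c * a * (2 * 2 * a) ^+ k = 2 ^+ k * (c * a ^+ k.+1 * 2 ^+ k).
    by rewrite !exprMn exprS; ring.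
  rewrite ler_pM2l//; apply: le_trans (ltW M1); rewrite ler_pdivlMr ?mulr_gt0//.
  rewrite -[leLHS]mulrA ler_piMr ?mulr_ge0 ?exprn_ge0 ?ltW//.
  move: dup; rewrite exprVn -div1r ltr_pdivlMr//.
  by rewrite exprS; lra.
- set K := k.+3; pose M := (Num.truncn (C * (2 * a) ^+ K)).+1.
  have h0 : 0 <= C * (2 * a) ^+ K.
    by rewrite mulr_ge0 ?exprn_ge0// (le_trans ler01).
  have /andP[M1 M0] := truncn_itv h0; rewrite -/M in M0.
  exists ((2 ^ K).+1 * (M.*2.+1))%N.
    apply: graph_cover => [||x y]; first by rewrite expn_gt0.
      by rewrite natrX exprS invfM mulrA divff// mul1r -exprVn.
    rewrite natrX -exprVn => /hg xy; apply: (le_trans xy).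
    rewrite exprVn ler_pdivlMr// (le_trans _ (ltW M0))//.
    by rewrite exprMn -mulrA [a ^+ K * _]mulrC lexx.
  rewrite natrM -natr1 natrX -[M.*2.+1%:R]natr1 -muln2 natrM -[M%:R]natr1.
  have -> : 2 * (2 * C + 3) * (2 * 2 * a) ^+ 3 * (2 * 2 * a) ^+ k =
      (2 ^+ K + 2 ^+ K) * (2 * C * (2 * a) ^+ K + 3 * (2 * a) ^+ K).
    rewrite -mulrA -exprD add3n -/K !exprMn; ring.
  have a2K : 1 <= (2 * a) ^+ K by rewrite exprn_ege1.
  apply: ler_pM; [by rewrite addr_ge0 ?ltW | by rewrite addr_ge0 | |].
    by rewrite lerD2l exprn_ege1// ler1n.
  lra.
Qed.

(** * The tent map and the Takagi function *)

(** The distance from x to the nearest integer. *)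
Definition tent (R : realType) (x : R) : R :=
  `|x - (Num.floor (x + 2^-1))%:~R|.

Lemma tent_le_dist (R : realType) (x : R) (m : int) : tent x <= `|x - m%:~R|.
Proof.
rewrite /tent; set n := Num.floor _.
have /andP[] := floor_itv (x + 2^-1); rewrite -/n intrD1 => n0 n1.
have [->//|] := eqVneq m n; rewrite neq_lt => /orP[mn|nm].
- have : m%:~R + 1 <= n%:~R :> R by rewrite -intrD1 ler_int lezD1.
  move=> mn'; rewrite [leRHS]ger0_norm; last lra.
  by rewrite ler_norml; lra.
- have : n%:~R + 1 <= m%:~R :> R by rewrite -intrD1 ler_int lezD1.
  move=> nm'; rewrite [leRHS]ler0_norm; last lra.
  by rewrite ler_norml; lra.
Qed.

Lemma tent_ge0 (R : realType) (x : R) : 0 <= tent x.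
Proof. exact: normr_ge0. Qed.

Lemma tent_le1 (R : realType) (x : R) : tent x <= 1.
Proof.
apply: (le_trans (tent_le_dist x (Num.floor x))).
have /andP[] := floor_itv x; rewrite intrD1 => x0 x1.
by rewrite ler_norml; lra.
Qed.

Lemma tent_lipschitz (R : realType) (x y : R) :
  `|tent x - tent y| <= `|x - y|.
Proof.
have half (u v : R) : tent u <= tent v + `|u - v|.
  apply: (le_trans (tent_le_dist u (Num.floor (v + 2^-1)))).
  rewrite [leRHS]addrC.
  have := ler_normD (u - v) (v - (Num.floor (v + 2^-1))%:~R).
  by rewrite addrA subrK; apply.
have := half x y; have := half y x; rewrite [`|y - x|]distrC => h1 h2.
by rewrite ler_norml; lra.
Qed.

Lemma tent_up (R : realType) (m : int) (x : R) :
  m%:~R <= x <= m%:~R + 2^-1 -> tent x = x - m%:~R.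
Proof.
move=> /andP[mx xm]; apply/eqP; rewrite eq_le; apply/andP; split.
  by rewrite (le_trans (tent_le_dist x m))// ger0_norm ?subr_ge0.
rewrite /tent; set n := Num.floor _; have [nm|mn] := leP n m.
  have : n%:~R <= m%:~R :> R by rewrite ler_int.
  by move=> ?; rewrite (le_trans _ (ler_norm _))//; lra.
have : m%:~R + 1 <= n%:~R :> R by rewrite -intrD1 ler_int lezD1.
by move=> ?; rewrite distrC (le_trans _ (ler_norm _))//; lra.
Qed.

Lemma tent_down (R : realType) (m : int) (x : R) :
  m%:~R + 2^-1 <= x <= m%:~R + 1 -> tent x = m%:~R + 1 - x.
Proof.
move=> /andP[mx xm]; apply/eqP; rewrite eq_le; apply/andP; split.
  rewrite (le_trans (tent_le_dist x (m + 1)))// intrD1 distrC.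
  by rewrite ger0_norm ?subr_ge0.
rewrite /tent; set n := Num.floor _; have [nm|mn] := leP n m.
  have : n%:~R <= m%:~R :> R by rewrite ler_int.
  by move=> ?; rewrite (le_trans _ (ler_norm _))//; lra.
have : m%:~R + 1 <= n%:~R :> R by rewrite -intrD1 ler_int lezD1.
by move=> ?; rewrite distrC (le_trans _ (ler_norm _))//; lra.
Qed.

(** The kinks of tent are at the half-integers, so tent is affine on
    [n / 2, (n + 1) / 2]. *)
Lemma tent_affine (R : realType) (n : nat) (x y : R) :
  n%:R <= 2 * x <= n%:R + 1 -> n%:R <= 2 * y <= n%:R + 1 ->
  tent x + tent y = 2 * tent ((x + y) / 2).
Proof.
rewrite -(odd_double_half n) natrD -muln2 natrM; set m := n./2.
have mE : m%:R = (m%:Z)%:~R :> R by [].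
rewrite mE => /andP[x0 x1] /andP[y0 y1].
case: (odd n) x0 x1 y0 y1 => /= x0 x1 y0 y1.
- by rewrite !(@tent_down _ m) //; lra.
- by rewrite !(@tent_up _ m) //; lra.
Qed.

Lemma tent_nat (R : realType) (n : nat) : tent (n%:R : R) = 0.
Proof. by rewrite (@tent_up _ n) ?subrr// lexx/= lerDl invr_ge0. Qed.

Lemma tent_half (R : realType) (n : nat) : tent (n%:R + 2^-1 : R) = 2^-1.
Proof. by rewrite (@tent_up _ n) ?lexx ?andbT ?lerDl ?invr_ge0//; lra. Qed.

Definition takagi_partial (R : realType) (a : R) (n : nat) (x : R) : R :=
  \sum_(0 <= i < n) a ^+ i * tent (2 ^+ i * x).

Definition takagi (R : realType) (a x : R) : R :=
  limn (takagi_partial a ^~ x).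

Lemma takagi_partialS (R : realType) (a : R) (n : nat) (x : R) :
  takagi_partial a n.+1 x = takagi_partial a n x + a ^+ n * tent (2 ^+ n * x).
Proof. by rewrite /takagi_partial big_nat_recr. Qed.

Lemma takagi_cvg (R : realType) (a x : R) : 0 < a -> a < 1 ->
  takagi_partial a ^~ x @ \oo --> takagi a x.
Proof.
move=> a0 a1; have a_ge0 n : 0 <= a ^+ n by rewrite exprn_ge0// ltW.
suff : cvgn (series (fun i => a ^+ i * tent (2 ^+ i * x))) by [].
apply: (@series_le_cvg _ _ (geometric 1 a)) => [n|n|n|].
- by rewrite mulr_ge0// tent_ge0.
- by rewrite /= mul1r.
- by rewrite /= mul1r ler_piMr// tent_le1.
- by apply: is_cvg_geometric_series; rewrite gtr0_norm.
Qed.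

Lemma norm_lim_le (R : realType) (u : nat -> R) (l B : R) :
  u @ \oo --> l -> (\forall n \near \oo, `|u n| <= B) -> `|l| <= B.
Proof.
move=> ul uB; have nul : `|u n| @[n --> \oo] --> `|l| by exact: cvg_norm.
by rewrite -(cvg_lim _ nul)//; apply: limr_le => //; apply/cvg_ex; exists `|l|.
Qed.

Lemma takagi_bounded (R : realType) (a x : R) : 0 < a -> a < 1 ->
  `|takagi a x| <= (1 - a)^-1.
Proof.
move=> a0 a1; have a_ge0 n : 0 <= a ^+ n by rewrite exprn_ge0// ltW.
apply: (norm_lim_le (@takagi_cvg _ _ x a0 a1)); apply: nearW => n.
have : `|takagi_partial a n x| <= (1 - a ^+ n) / (1 - a).
  elim: n => [|n IH].
    by rewrite /takagi_partial big_geq// normr0 expr0 subrr mul0r.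
  rewrite takagi_partialS (le_trans (ler_normD _ _))//.
  rewrite normrM (ger0_norm (a_ge0 n)) (ger0_norm (tent_ge0 _)).
  have -> : (1 - a ^+ n.+1) / (1 - a) = (1 - a ^+ n) / (1 - a) + a ^+ n.
    by rewrite exprS; field; rewrite subr_eq0 gt_eqF.
  by rewrite lerD// ler_piMr// tent_le1.
move/le_trans; apply; rewrite ler_pdivrMr ?subr_gt0// mulVf; last first.
  by rewrite subr_eq0 gt_eqF.
by rewrite lerBlDr lerDl.
Qed.

(** The terms of index below k are controlled by their Lipschitz constants
    (2 a) ^ i, whose sum is dominated by its last term because 2 a > 1; the
    others by their size a ^ i, whose sum is dominated by its first term because
    a < 1. *)
Lemma takagi_dyadic_holder (R : realType) (a : R) : 1 < 2 * a -> a < 1 ->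
  dyadic_holder a ((2 * a - 1)^-1 + (1 - a)^-1) (takagi a).
Proof.
move=> a2 a1 k x y xy; have a0 : 0 < a by lra.
have a_ge0 n : 0 <= a ^+ n by rewrite exprn_ge0// ltW.
pose d n := takagi_partial a n x - takagi_partial a n y.
have dS n : d n.+1 = d n + a ^+ n * (tent (2 ^+ n * x) - tent (2 ^+ n * y)).
  by rewrite /d !takagi_partialS; ring.
have low n : `|d n| <= (2 * a) ^+ n / (2 * a - 1) * `|x - y|.
  elim: n => [|n IH].
    rewrite /d /takagi_partial !big_geq// subrr normr0.
    by rewrite mulr_ge0// divr_ge0// ?exprn_ge0; lra.
  rewrite dS (le_trans (ler_normD _ _))//.
  have -> : (2 * a) ^+ n.+1 / (2 * a - 1) * `|x - y| =
      (2 * a) ^+ n / (2 * a - 1) * `|x - y| + a ^+ n * (2 ^+ n * `|x - y|).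
    by rewrite exprS exprMn; field; rewrite subr_eq0 gt_eqF.
  rewrite lerD// normrM (ger0_norm (a_ge0 n)) ler_wpM2l//.
  rewrite (le_trans (tent_lipschitz _ _))// -mulrBr normrM.
  by rewrite (ger0_norm (exprn_ge0 n (ler0n R 2))).
have high m : `|d (k + m)%N| <= `|d k| + (a ^+ k - a ^+ (k + m)) / (1 - a).
  elim: m => [|m IH]; first by rewrite addn0 subrr mul0r addr0.
  rewrite addnS dS (le_trans (ler_normD _ _))//.
  have -> : `|d k| + (a ^+ k - a ^+ (k + m).+1) / (1 - a) =
      `|d k| + (a ^+ k - a ^+ (k + m)) / (1 - a) + a ^+ (k + m).
    by rewrite exprS; field; rewrite subr_eq0 gt_eqF.
  rewrite lerD// normrM (ger0_norm (a_ge0 _)) ler_piMr// ler_norml.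
  have := tent_ge0 (2 ^+ (k + m) * x); have := tent_le1 (2 ^+ (k + m) * x).
  have := tent_ge0 (2 ^+ (k + m) * y); have := tent_le1 (2 ^+ (k + m) * y).
  lra.
apply: (norm_lim_le (cvgB (@takagi_cvg _ _ x a0 a1) (@takagi_cvg _ _ y a0 a1))).
exists k => // n /= kn; rewrite -(subnKC kn) (le_trans (high _))//.
rewrite [leRHS]mulrDl.
apply: lerD.
  apply: (le_trans (low k)).
  have -> : (2 * a - 1)^-1 * a ^+ k = (2 * a) ^+ k / (2 * a - 1) * 2^-1 ^+ k.
    rewrite exprMn exprVn; field.
    by rewrite expf_neq0// subr_eq0 gt_eqF.
  by rewrite ler_wpM2l// divr_ge0 ?exprn_ge0//; lra.
rewrite mulrC ler_wpM2l ?invr_ge0 ?subr_ge0 ?(ltW a1)//.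
by rewrite lerBlDr lerDl.
Qed.

(** Of the terms of the series only the one of index k contributes: for i < k
    the three points lie in an interval where the term is affine, and for i > k
    the term vanishes at all three. *)
Lemma takagi_second_difference (R : realType) (a : R) (k j : nat) :
  0 < a -> a < 1 ->
  takagi a (j%:R / 2 ^+ k) + takagi a ((j%:R + 1) / 2 ^+ k) -
    2 * takagi a ((j%:R + 2^-1) / 2 ^+ k) = - a ^+ k.
Proof.
move=> a0 a1.
have pow2 n : (2 : R) ^+ n != 0 by rewrite expf_neq0.
set x := _ / _; set y := _ / _; set z := _ / _.
pose D (f : R -> R) := f x + f y - 2 * f z.
have termE i : D (fun t => tent (2 ^+ i * t)) = - (i == k)%:R.
  rewrite /D /x /y /z; have [ik|ki|->] := ltngtP i k.
  (* In units of 2 ^ (- i - 1), the interval is [j / q, (j + 1) / q], which lies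
     between consecutive integers. *)
  - pose q := (2 ^ (k - i.+1))%N; pose m := (j %/ q)%N.
    have q0 : (0 < q)%N by rewrite expn_gt0.
    have scale t : 2 ^+ i * (t / 2 ^+ k) = t / q%:R / 2 :> R.
      rewrite -[in LHS](subnKC ik) exprD exprS natrX; field.
      by rewrite !pow2.
    rewrite !scale.
    have mj : m%:R <= j%:R / q%:R :> R.
      by rewrite ler_pdivlMr ?ltr0n// -natrM ler_nat leq_divM.
    have jm : (j%:R + 1) / q%:R <= m%:R + 1 :> R.
      by rewrite ler_pdivrMr ?ltr0n// !natr1 -natrM ler_nat ltn_ceil.
    have jj : j%:R / q%:R <= (j%:R + 1) / q%:R :> R.
      by rewrite ler_pM2r ?invr_gt0 ?ltr0n// lerDl.
    have -> : (j%:R + 2^-1) / q%:R / 2 =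
        (j%:R / q%:R / 2 + (j%:R + 1) / q%:R / 2) / 2 :> R.
      by field; rewrite pnatr_eq0 -lt0n.
    rewrite (@tent_affine _ m) ?subrr ?oppr0//; lra.
  - have scale t : 2 ^+ i * (t / 2 ^+ k) = 2 ^+ (i - k.+1) * (2 * t) :> R.
      by rewrite -[in LHS](subnKC ki) exprD exprS; field; exact: pow2.
    have -> : 2 ^+ i * (j%:R / 2 ^+ k) = (2 ^ (i - k.+1) * (2 * j))%:R :> R.
      by rewrite scale !natrM natrX.
    have -> : 2 ^+ i * ((j%:R + 1) / 2 ^+ k) =
        (2 ^ (i - k.+1) * (2 * j.+1))%:R :> R.
      by rewrite scale !natrM natrX natr1.
    have -> : 2 ^+ i * ((j%:R + 2^-1) / 2 ^+ k) =
        (2 ^ (i - k.+1) * (2 * j).+1)%:R :> R.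
      by rewrite scale natrM natrX -[(2 * j).+1%:R]natr1 natrM mulrDr divff.
    by rewrite !tent_nat mulr0 addr0 subrr oppr0.
  - rewrite ![2 ^+ k * _]mulrC !mulfVK//.
    by rewrite tent_half natr1 !tent_nat addr0 sub0r divff.
have partialE n : (k < n)%N -> D (takagi_partial a n) = - a ^+ k.
  move=> kn.
  have -> : D (takagi_partial a n) =
      \sum_(0 <= i < n) a ^+ i * D (fun t => tent (2 ^+ i * t)).
    rewrite /D /takagi_partial mulr_sumr -big_split -sumrB/=.
    by apply: eq_bigr => i _; ring.
  rewrite big_mkord (bigD1 (Ordinal kn))//= termE eqxx mulrN1 big1 ?addr0//.
  move=> i ik; rewrite termE.
  by rewrite (_ : (i == k :> nat) = false) ?oppr0 ?mulr0//; exact: negbTE.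
have D_cvg : D (takagi_partial a n) @[n --> \oo] --> D (takagi a).
  apply: cvgB; first by apply: cvgD; exact: takagi_cvg.
  by apply: cvgM; [exact: cvg_cst | exact: takagi_cvg].
rewrite -[LHS](cvg_lim _ D_cvg)//; apply: cvg_lim => //; apply: cvg_near_cst.
by exists k.+1.
Qed.

(** * Lipschitz perturbations of the Takagi function *)

(** The second difference of p is at most L * 2 ^ (-k), which is below
    eps / 2 * a ^ k for large k as 2 a > 1.  So the midpoint value of the sum
    exceeds the mean of the two end values by at least eps / 4 * a ^ k, and
    hence exceeds one of them by as much. *)
Lemma box_dim_lipschitz_add_takagi (R : realType) (beta eps L : R)
    (p : R -> R) :
  1 < beta -> beta < 2 -> 0 < eps -> 0 <= L ->
  (forall x y, `|p x - p y| <= L * `|x - y|) ->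
  box_dim_eq (graph_on_I (fun x => p x + eps * takagi (2 `^ (beta - 2)) x))
    beta.
Proof.
move=> b1 b2 eps0 L0 pL.
have [a2 a1] := powR2_subr2_bounds b1 b2.
set a := 2 `^ (beta - 2) in a2 a1 *.
have a0 : 0 < a by lra.
have half_a k : 2^-1 ^+ k <= a ^+ k by rewrite lerXn2r ?nnegrE; lra.
have q_lt1 : `|(2 * a)^-1| < 1.
  by rewrite gtr0_norm ?invr_gt0 ?invf_lt1; lra.
have e' : 0 < eps / 2 / (L + 1) by rewrite !divr_gt0// ltr_wpDl.
have [k0 _ small] := cvgr0_norm_le _ (cvg_expr q_lt1) _ e'.
apply: (@box_dim_graph _ _ (eps / 4)
  (L + eps * ((2 * a - 1)^-1 + (1 - a)^-1)) k0) => //.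
- by rewrite divr_gt0.
- by rewrite addr_ge0// mulr_ge0 ?ltW// addr_gt0// invr_gt0 subr_gt0.
- move=> k x y xy; rewrite -/a opprD addrACA -mulrBr mulrDl.
  rewrite (le_trans (ler_normD _ _))// lerD//.
    rewrite (le_trans (pL _ _))// ler_wpM2l// (le_trans xy)//.
  rewrite normrM gtr0_norm// -mulrA ler_wpM2l ?(ltW eps0)//.
  exact: takagi_dyadic_holder.
move=> k j k0k; rewrite -/a.
have pow2 : 0 < (2 : R) ^+ k by rewrite exprn_gt0.
have Lk : L * 2^-1 ^+ k <= eps / 2 * a ^+ k.
  have := small k k0k; rewrite /= normrX gtr0_norm ?invr_gt0; last lra.
  rewrite ler_pdivlMr ?ltr_wpDl// invfM exprMn [a^-1 ^+ k]exprVn => qk.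
  rewrite -ler_pdivrMr ?exprn_gt0//; apply: le_trans qk.
  rewrite -mulrA mulrC ler_wpM2l ?lerDl//.
  by rewrite mulr_ge0// ?invr_ge0 exprn_ge0// ltW.
have := @takagi_second_difference _ a k j a0 a1.
set x := _ / _; set y := _ / _; set z := _ / _ => sd.
have scale (t : R) : 2 ^+ k * (t / 2 ^+ k) = t by rewrite mulrC mulfVK// gt_eqF.
have half0 : 0 <= 2^-1 ^+ k / 2 :> R by rewrite divr_ge0// exprn_ge0.
have zx : z - x = 2^-1 ^+ k / 2.
  by rewrite /z /x exprVn; field; rewrite gt_eqF.
have yz : y - z = 2^-1 ^+ k / 2.
  by rewrite /y /z exprVn; field; rewrite gt_eqF.
have pxz : `|p z - p x| <= L * (2^-1 ^+ k / 2).
  by apply: (le_trans (pL z x)); rewrite zx ger0_norm.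
have pyz : `|p y - p z| <= L * (2^-1 ^+ k / 2).
  by apply: (le_trans (pL y z)); rewrite yz ger0_norm.
move: pxz pyz; rewrite !ler_norml => /andP[px _] /andP[_ py].
have {sd} := congr1 ( *%R eps) sd; rewrite mulrBr mulrDr mulrN => sd.
have [xz|xz] := leP (p x + eps * takagi a x + eps / 4 * a ^+ k)
                    (p z + eps * takagi a z).
- by exists x, z; rewrite !scale; split=> //; lra.
- by exists y, z; rewrite !scale; split=> //; lra.
Qed.

(** * Lipschitz approximation *)

Lemma uniformly_continuous_on_I (R : realType) (f : R -> R) (e : R) :
  {within @unit_interval R, continuous f} -> 0 < e ->
  exists2 d : R, 0 < d & forall x y, @unit_interval R x -> @unit_interval R y ->
    `|x - y| < d -> `|f x - f y| <= e.
Proof.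
move=> /subspace_continuousP cf e0.
have e2 : 0 < e / 2 by rewrite divr_gt0.
pose P (d x : R) := forall y, @unit_interval R x -> @unit_interval R y ->
  `|x - y| < d -> `|f x - f y| <= e.
have /compact_near_coveringP/(_ R (0 : R)^'+ P) cover :
  compact (@unit_interval R) := @segment_compact _ 0 1.
have [d [d0 dP]] : exists d, 0 < d /\ @unit_interval R `<=` P d.
- suff : \forall d \near (0 : R)^'+, 0 < d /\ @unit_interval R `<=` P d.
    by move=> /filter_ex [d ?]; exists d.
  near=> d; split; first by near: d; exact: nbhs_right_gt.
  near: d; apply: cover => x Ix.
  have [r /= r0 fr] := cvgr_dist_le _ _ (cf x Ix) _ e2.
  have r2 : 0 < r / 2 by rewrite divr_gt0.
  exists (ball x (r / 2), [set d | d < r / 2]).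
    by split => /=; [exact: nbhsx_ballx | exact: nbhs_right_lt].
  move=> [x' d] [/= xx' dr] y Ix' Iy x'y.
  have fx' : `|f x - f x'| <= e / 2.
    by apply: fr => //=; move: xx'; rewrite /ball/=; lra.
  have fy : `|f x - f y| <= e / 2.
    apply: fr => //=; rewrite -(subrKA x') (le_lt_trans (ler_normD _ _))//.
    by move: xx'; rewrite /ball/=; lra.
  rewrite -(subrKA (f x)) (le_trans (ler_normD _ _))// [`|f x' - _|]distrC.
  by move: fx' fy; lra.
by exists d => // x y Ix Iy; exact: dP.
Unshelve. all: by end_near.
Qed.

Definition clamp (R : realType) (t : R) : R := Num.max 0 (Num.min 1 t).

Lemma clamp_lipschitz (R : realType) (s t : R) :
  `|clamp s - clamp t| <= `|s - t|.
Proof.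
wlog st : s t / s <= t.
  by move=> wl; have [|/ltW] := leP s t => /wl //; rewrite distrC [leRHS]distrC.
rewrite [leRHS]distrC [leRHS]ger0_norm ?subr_ge0// ler_norml.
by rewrite /clamp !maxEle !minEle; do 4?[case: ifPn]; rewrite -?ltNge; lra.
Qed.

(** The tent of height 1 supported by [-1, 1].  Written as a difference of two
    ramps, its integer translates sum to 1 by telescoping. *)
Definition hat (R : realType) (t : R) : R := clamp (t + 1) - clamp t.

Lemma hat_ge0 (R : realType) (t : R) : 0 <= hat t.
Proof.
by rewrite /hat /clamp !maxEle !minEle; do 4?[case: ifPn]; rewrite -?ltNge; lra.
Qed.

Lemma hat_eq0 (R : realType) (t : R) : 1 <= `|t| -> hat t = 0.
Proof.
rewrite ler_normr /hat /clamp !maxEle !minEle.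
by move=> /orP[]; do 4?[case: ifPn]; rewrite -?ltNge; lra.
Qed.

Lemma hat_lipschitz (R : realType) (s t : R) :
  `|hat s - hat t| <= 2 * `|s - t|.
Proof.
have -> : hat s - hat t = (clamp (s + 1) - clamp (t + 1)) + (clamp t - clamp s).
  by rewrite /hat; ring.
rewrite (le_trans (ler_normD _ _))//.
have := clamp_lipschitz (s + 1) (t + 1); have := clamp_lipschitz t s.
by rewrite [`|t - s|]distrC (_ : s + 1 - (t + 1) = s - t); [lra | ring].
Qed.

Lemma hat_partition (R : realType) (n : nat) (t : R) : 0 <= t <= n%:R ->
  \sum_(0 <= i < n.+1) hat (t - i%:R) = 1.
Proof.
move=> /andP[t0 tn].
transitivity (- \sum_(0 <= i < n.+1)
    (clamp (t + 1 - i.+1%:R) - clamp (t + 1 - i%:R))).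
  rewrite -sumrN; apply: eq_bigr => i _; rewrite opprB /hat -natr1.
  by congr (clamp _ - clamp _); ring.
rewrite telescope_sumr// -natr1 subr0 opprB /clamp !maxEle !minEle.
by do 4?[case: ifPn]; rewrite -?ltNge; lra.
Qed.

(** The interpolant p of f at the multiples of 1 / n averages values of f at
    points within 1 / n of x, with the weights of the partition of unity by hat
    functions. *)
Lemma lipschitz_approximation (R : realType) (f : R -> R) (e : R) :
  {within @unit_interval R, continuous f} -> 0 < e ->
  exists p L, [/\ 0 <= L, forall x y, `|p x - p y| <= L * `|x - y| &
    forall x, @unit_interval R x -> `|f x - p x| <= e].
Proof.
move=> cf e0; have [d d0 fd] := uniformly_continuous_on_I cf e0.
pose n := (Num.truncn d^-1).+1.
have n0 : 0 < n%:R :> R by rewrite ltr0n.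
have nd : n%:R^-1 < d.
  have di : 0 <= d^-1 by rewrite invr_ge0 ltW.
  by have /andP[_] := truncn_itv di; rewrite invf_plt ?posrE.
pose v i := f (i%:R / n%:R).
pose p x := \sum_(0 <= i < n.+1) v i * hat (n%:R * x - i%:R).
exists p, (\sum_(0 <= i < n.+1) `|v i| * (2 * n%:R)); split.
- by apply: sumr_ge0 => i _; rewrite !mulr_ge0.
- move=> x y; rewrite /p -sumrB mulr_suml (le_trans (ler_norm_sum _ _ _))//.
  apply: ler_sum => i _; rewrite -mulrBr normrM -mulrA ler_wpM2l//.
  rewrite (le_trans (hat_lipschitz _ _))// opprB addrA subrK -mulrBr normrM.
  by rewrite gtr0_norm// mulrA.
move=> x Ix; have := Ix; rewrite /unit_interval/= in_itv/= => /andP[x0 x1].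
have part : \sum_(0 <= i < n.+1) hat (n%:R * x - i%:R) = 1.
  by apply: hat_partition; rewrite mulr_ge0 ?(ltW n0)//= ler_piMr ?(ltW n0).
have average c : c = \sum_(0 <= i < n.+1) c * hat (n%:R * x - i%:R).
  by rewrite -mulr_sumr part mulr1.
rewrite [f x]average [e]average -sumrB (le_trans (ler_norm_sum _ _ _))//.
rewrite !big_nat; apply: ler_sum => i /= ilt.
rewrite -mulrBl normrM (ger0_norm (hat_ge0 _)).
have [far|near_i] := leP 1 `|n%:R * x - i%:R|.
  by rewrite hat_eq0// !mulr0.
rewrite ler_wpM2r ?hat_ge0//; apply: fd => //.
  rewrite /unit_interval/= in_itv/= divr_ge0 ?(ltW n0)//=.
  by rewrite ler_pdivrMr// mul1r ler_nat.
apply: lt_trans nd; rewrite -(ltr_pM2l n0) divff ?gt_eqF//.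
rewrite -{1}(gtr0_norm n0) -normrM mulrBr [n%:R * (_ / _)]mulrC.
by rewrite mulfVK ?gt_eqF.
Qed.

(** * Continuous functions as fractal functions *)

Definition halving_node (R : realType) (i : nat) : R := i%:R / 2.

Definition halving_map (R : realType) (i : 'I_2) (t : R) : R :=
  t / 2 + halving_node R i.

(** The term (y - g x) / 2 vanishes on the graph of g, which is therefore mapped
    into itself; it makes the vertical contraction factor 1/2 instead of 0. *)
Definition graph_map (R : realType) (g : R -> R) (i : 'I_2) (x y : R) : R :=
  g (halving_map i x) + (y - g x) / 2.

Lemma halving_map0 (R : realType) (i : 'I_2) :
  halving_map i (halving_node R 0) = halving_node R i.
Proof. by rewrite /halving_map /halving_node !mul0r add0r. Qed.

Lemma halving_map1 (R : realType) (i : 'I_2) :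
  halving_map i (halving_node R 2) = halving_node R i.+1.
Proof. by rewrite /halving_map /halving_node -natr1; field. Qed.

Lemma graph_map_fix (R : realType) (g : R -> R) (i : 'I_2) (x : R) :
  graph_map g i x (g x) = g (halving_map i x).
Proof. by rewrite /graph_map subrr mul0r addr0. Qed.

Lemma graph_map_continuous (R : realType) (g : R -> R) (i : 'I_2) (y : R) :
  continuous g -> {within @unit_interval R, continuous (graph_map g i ^~ y)}.
Proof.
move=> cg; apply: continuous_subspaceT => x; apply: cvgD.
  apply: (continuous_comp (f := halving_map i)); last exact: cg.
  apply: cvgD; last exact: cvg_cst.
  by apply: cvgM; [exact: cvg_id | exact: cvg_cst].
by apply: cvgM; [apply: cvgB; [exact: cvg_cst | exact: cg] | exact: cvg_cst].
Qed.

Lemma graph_map_contractive (R : realType) (g : R -> R) (i : 'I_2) :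
  exists c : R, [/\ 0 <= c, c < 1 & forall x y y', @unit_interval R x ->
    `|graph_map g i x y - graph_map g i x y'| <= c * `|y - y'|].
Proof.
exists 2^-1; split; [lra | lra | move=> x y y' _].
have -> : graph_map g i x y - graph_map g i x y' = 2^-1 * (y - y').
  by rewrite /graph_map; field.
by rewrite normrM ger0_norm.
Qed.

Lemma halving_map_affine (R : realType) (i : 'I_2) :
  affine_map (@halving_map R i).
Proof. by exists 2^-1, (halving_node R i) => t; rewrite mulrC. Qed.

Lemma halving_node_incr (R : realType) (i : 'I_2) :
  halving_node R i < halving_node R i.+1.
Proof. by rewrite ltr_pM2r ?invr_gt0// ltr_nat. Qed.

Lemma halving_node_last (R : realType) : halving_node R 2 = 1.
Proof. by rewrite /halving_node divff. Qed.

Definition graph_ifs (R : realType) (g : R -> R) (cg : continuous g) :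
  fractal_ifs R.
Proof.
refine (@FractalIFS R 2 (halving_node R) (fun i => g (halving_node R i))
  (@halving_map R) (graph_map g) isT (mul0r _) (halving_node_last R)
  (@halving_node_incr R) (@halving_map_affine R) (@halving_map0 R)
  (@halving_map1 R) (fun i y => @graph_map_continuous R g i y cg)
  (graph_map_contractive g) _ _) => i.
- by rewrite graph_map_fix halving_map0.
- by rewrite graph_map_fix halving_map1.
Defined.

Lemma continuous_fractal_function (R : realType) (g : R -> R) :
  continuous g -> fractal_function g.
Proof.
move=> cg; exists (graph_ifs cg); split=> //.
  exact: continuous_subspaceT.
have unitE (t : R) : @unit_interval R t = (0 <= t <= 1) :> Prop.
  by rewrite /unit_interval/= in_itv.
split; [by move=> _ [x Ix <-] | exact: graph_nonempty | exact: graph_compact |].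
apply/seteqP; split => [_ [x Ix <-]|_ [i _ [_ [x Ix <-] <-]]]; last first.
  exists (halving_map i x); last by rewrite /ifs_w/= graph_map_fix.
  move: Ix; rewrite !unitE /halving_map /halving_node.
  by case: i => [[|[|//]] ?] /=; lra.
pose i : 'I_2 := if x <= 2^-1 then ord0 else ord_max.
exists i => //.
have xE : halving_map i (2 * x - i%:R) = x.
  by rewrite /halving_map /halving_node; field.
exists (2 * x - i%:R, g (2 * x - i%:R)).
  exists (2 * x - i%:R) => //; move: Ix; rewrite !unitE /i.
  by case: (leP x 2^-1) => /=; lra.
by rewrite /ifs_w/= graph_map_fix xE.
Qed.

(** * Density of the fractal functions of dimension beta *)

Theorem theorem3p16 (R : realType) (f : R -> R) (beta : R)
    (hf : {within @unit_interval R, continuous f})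
    (hbeta1 : 1 < beta) (hbeta2 : beta < 2) :
  exists f_ : nat -> R -> R,
    [/\ forall n, fractal_function (f_ n),
        {uniform @unit_interval R, f_ @ \oo --> f} &
        forall n, box_dim_eq (graph_on_I (f_ n)) beta].
Proof.
have [a2 a1] := powR2_subr2_bounds hbeta1 hbeta2.
set a := 2 `^ (beta - 2) in a2 a1.
have a0 : 0 < a by lra.
have approx (n : nat) : exists g : R -> R, [/\ fractal_function g,
    box_dim_eq (graph_on_I g) beta &
    forall x, @unit_interval R x -> `|f x - g x| <= n.+1%:R^-1].
  have e0 : 0 < (n.+1%:R : R)^-1 / 2 by rewrite divr_gt0 ?invr_gt0.
  have [p [L [L0 pL fp]]] := lipschitz_approximation hf e0.
  (* takagi is bounded by 1 / (1 - a), so eps * takagi is bounded by half of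
     1 / (n + 1). *)
  pose eps : R := n.+1%:R^-1 / 2 * (1 - a).
  have eps0 : 0 < eps by rewrite mulr_gt0// subr_gt0.
  exists (fun x => p x + eps * takagi a x); split.
  - apply: continuous_fractal_function => x; apply: cvgD.
      apply: (@dyadic_holder_continuous _ 2^-1 L) => // [|k y z yz]; first lra.
      by rewrite (le_trans (pL _ _))// ler_wpM2l.
    apply: cvgM; first exact: cvg_cst.
    apply: (dyadic_holder_continuous a0 a1); last exact: takagi_dyadic_holder.
    by rewrite addr_ge0 ?invr_ge0//; lra.
  - exact: (@box_dim_lipschitz_add_takagi _ _ _ L).
  move=> x Ix; rewrite opprD addrA (le_trans (ler_normD _ _))//.
  rewrite [leRHS]splitr lerD ?fp// normrN normrM gtr0_norm// -mulrA.
  rewrite ler_piMr ?(ltW e0)// mulrC -ler_pdivlMr ?subr_gt0// div1r.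
  exact: takagi_bounded.
have [f_ f_P] := choice approx.
exists f_; split=> [n||n]; [by have [] := f_P n| |by have [] := f_P n].
move=> U /uniform_nbhs [E [entE EU]].
have [e /= e0 eE] : exists2 e : R, 0 < e & forall y z, `|y - z| < e -> E (y, z).
  move: entE; rewrite -entourage_ballE => -[e /= e0 eE]; exists e => // y z yz.
  exact: eE.
near=> n; apply: EU => x Ix; apply: eE; have [_ _ fn] := f_P n.
apply: le_lt_trans (fn x Ix) _.
by near: n; exact: near_infty_natSinv_lt (PosNum e0).
Unshelve. all: by end_near.
Qed.
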